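(* Let $K$ be a field and let $R$ be a finite-dimensional $K$-algebra such that $(R^* )^{\otimes_R n}\simeq R$ as $R$-bimodules for some integer $n\geq 2$ (note that $R$ is necessarily quasi-Frobenius). Then any morphism of $R$-bimodules $\varphi:(R^* )^{\otimes_R n}\to R$ is associative.
   Context: $R^*=\mathrm{Hom}_K(R,K)$ is an $R$-bimodule via $(r\rightharpoonup r^* )(s)=r^*(sr)$ and $(r^*\leftharpoonup r)(s)=r^*(rs)$. $(R^* )^{\otimes_R n}$ is the $n$-fold tensor product of $R^*$ over $R$. For an $R$-bimodule $M$, a bimodule morphism $\varphi:M^{\otimes_R n}\to R$ is associative if $\varphi(m_1\otimes_R\cdots\otimes_R m_n)m_{n+1}=m_1\varphi(m_2\otimes_R\cdots\otimes_R m_{n+1})$ for all $m_1,\ldots,m_{n+1}\in M$. A finite-dimensional algebra $R$ is quasi-Frobenius if $R$ is an injective left $R$-module. *)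

(* Defs.v *)
From HB Require Import structures.
From mathcomp Require Import all_boot all_algebra all_field.
From mathcomp Require Import generic_quotient ring_quotient.
From mathcomp Require Import boolp.
From mathcomp Require Import freeg.

Set Implicit Arguments.
Unset Strict Implicit.
Unset Printing Implicit Defensive.

Import GRing.Theory.
Local Open Scope ring_scope.
Local Open Scope quotient_scope.

Reserved Notation "x ↼ r" (at level 40, left associativity).
Reserved Notation "x ⊗ y" (at level 40, left associativity).

(* The left action of a bimodule is the scaling [*:] of [lmodType R]. *)
HB.mixin Record Lmodule_isBimodule (R : nzRingType) M of GRing.Lmodule R M := {
  rscale : M -> R -> M;
  rscaleA : forall (x : M) (r s : R), rscale (rscale x r) s = rscale x (r * s);
  rscale1 : forall x : M, rscale x 1 = x;
  rscaleDl : forall (r : R) (x y : M),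
    rscale (x + y) r = rscale x r + rscale y r;
  rscaleDr : forall (x : M) (r s : R),
    rscale x (r + s) = rscale x r + rscale x s;
  rscaleAl : forall (r : R) (x : M) (s : R),
    rscale (r *: x) s = r *: rscale x s
}.

#[short(type="bimodType")]
HB.structure Definition Bimodule (R : nzRingType) :=
  {M of GRing.Lmodule R M & Lmodule_isBimodule R M}.

Notation "x ↼ r" := (rscale x r) : ring_scope.

Definition bimodule_morphism (R : nzRingType) (M N : bimodType R)
    (f : M -> N) : Prop :=
  linear f /\ (forall (x : M) (r : R), f (x ↼ r) = f x ↼ r).

Definition bimodule_iso (R : nzRingType) (M N : bimodType R) : Prop :=
  exists2 f : M -> N, bimodule_morphism f & bijective f.

Section RegularBimodule.
Variable R : nzRingType.

Definition regular_rscale (x : R^o) (r : R) : R^o := (x : R) * r.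

Fact regular_rscaleA (x : R^o) (r s : R) :
  regular_rscale (regular_rscale x r) s = regular_rscale x (r * s).
Proof. by rewrite /regular_rscale mulrA. Qed.

Fact regular_rscale1 (x : R^o) : regular_rscale x 1 = x.
Proof. exact: mulr1. Qed.

Fact regular_rscaleDl (r : R) (x y : R^o) :
  regular_rscale (x + y) r = regular_rscale x r + regular_rscale y r.
Proof. exact: mulrDl. Qed.

Fact regular_rscaleDr (x : R^o) (r s : R) :
  regular_rscale x (r + s) = regular_rscale x r + regular_rscale x s.
Proof. exact: mulrDr. Qed.

Fact regular_rscaleAl (r : R) (x : R^o) (s : R) :
  regular_rscale (r *: x) s = r *: regular_rscale x s.
Proof. by rewrite /regular_rscale /GRing.scale /= mulrA. Qed.

HB.instance Definition _ := Lmodule_isBimodule.Build R R^o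
  regular_rscaleA regular_rscale1 regular_rscaleDl regular_rscaleDr
  regular_rscaleAl.

End RegularBimodule.

Section Dual.
Variables (K : fieldType) (R : falgType K).

(* An alias, because ['Hom(R, K^o)] already carries its structure of
   [lmodType K]. *)
Definition dual : Type := 'Hom(R, K^o).

HB.instance Definition _ := GRing.Zmodule.copy dual 'Hom(R, K^o).

Definition dual_fun (f : dual) : R -> K := fun s => (f : 'Hom(R, K^o)) s.
Coercion dual_fun : dual >-> Funclass.

(* (r *: f) s = f (s * r) and (f ↼ r) s = f (r * s) *)
Definition dual_lscale (r : R) (f : dual) : dual :=
  ((f : 'Hom(R, K^o)) \o amulr r)%VF.
Definition dual_rscale (f : dual) (r : R) : dual :=
  ((f : 'Hom(R, K^o)) \o amull r)%VF.

Lemma dual_lscaleE r f s : dual_lscale r f s = f (s * r).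
Proof. by rewrite /dual_fun /dual_lscale comp_lfunE lfunE. Qed.

Lemma dual_rscaleE f r s : dual_rscale f r s = f (r * s).
Proof. by rewrite /dual_fun /dual_rscale comp_lfunE lfunE. Qed.

Lemma dualP (f g : dual) : (forall s, f s = g s) -> f = g.
Proof. by move=> fg; apply/lfunP => s; exact: fg. Qed.

Lemma dual_addE (f g : dual) s : dual_fun (f + g) s = f s + g s.
Proof. by rewrite /dual_fun add_lfunE. Qed.

Lemma dual_funD (f : dual) s t : dual_fun f (s + t) = f s + f t.
Proof. by rewrite /dual_fun raddfD. Qed.

Fact dual_lscaleA (r s : R) (f : dual) :
  dual_lscale r (dual_lscale s f) = dual_lscale (r * s) f.
Proof. by apply: dualP => t; rewrite !dual_lscaleE mulrA. Qed.

Fact dual_lscale1 : left_id 1 dual_lscale.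
Proof. by move=> f; apply: dualP => t; rewrite dual_lscaleE mulr1. Qed.

Fact dual_lscaleDr : right_distributive dual_lscale +%R.
Proof.
by move=> r f g; apply: dualP => t; rewrite !(dual_addE, dual_lscaleE).
Qed.

Fact dual_lscaleDl (f : dual) :
  {morph dual_lscale^~ f : r s / r + s >-> r + s}.
Proof.
move=> r s; apply: dualP => t.
by rewrite !(dual_addE, dual_lscaleE) mulrDr dual_funD.
Qed.

HB.instance Definition _ := GRing.Zmodule_isLmodule.Build R dual
  dual_lscaleA dual_lscale1 dual_lscaleDr dual_lscaleDl.

Fact dual_rscaleA (f : dual) (r s : R) :
  dual_rscale (dual_rscale f r) s = dual_rscale f (r * s).
Proof. by apply: dualP => t; rewrite !dual_rscaleE mulrA. Qed.

Fact dual_rscale1 (f : dual) : dual_rscale f 1 = f.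
Proof. by apply: dualP => t; rewrite dual_rscaleE mul1r. Qed.

Fact dual_rscaleDl (r : R) (f g : dual) :
  dual_rscale (f + g) r = dual_rscale f r + dual_rscale g r.
Proof. by apply: dualP => t; rewrite !(dual_addE, dual_rscaleE). Qed.

Fact dual_rscaleDr (f : dual) (r s : R) :
  dual_rscale f (r + s) = dual_rscale f r + dual_rscale f s.
Proof.
apply: dualP => t.
by rewrite !(dual_addE, dual_rscaleE) mulrDl dual_funD.
Qed.

Fact dual_rscaleAl (r : R) (f : dual) (s : R) :
  dual_rscale (r *: f) s = r *: dual_rscale f s.
Proof.
apply: dualP => t.
by rewrite /GRing.scale /= !(dual_lscaleE, dual_rscaleE) mulrA.
Qed.

HB.instance Definition _ := Lmodule_isBimodule.Build R dual
  dual_rscaleA dual_rscale1 dual_rscaleDl dual_rscaleDr dual_rscaleAl.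

End Dual.

Section Tensor.
Variables (R : nzRingType) (M N : bimodType R).

(* M ⊗_R N is the free abelian group on M * N modulo the usual relators. When
   R is an algebra over K, scalars of K act through R, so no separate
   K-bilinearity relators are needed. *)
Local Notation F := {freeg (M * N)%type / int}.

Inductive tensor_relator : F -> Prop :=
| TensorDl x x' y :
    tensor_relator (<< (x + x', y) >> - << (x, y) >> - << (x', y) >>)
| TensorDr x y y' :
    tensor_relator (<< (x, y + y') >> - << (x, y) >> - << (x, y') >>)
| TensorA x r y :
    tensor_relator (<< (x ↼ r, y) >> - << (x, r *: y) >>).

(* The subgroup generated by the relators; [boolp] makes membership in it a
   boolean predicate, as [Quotient.quot] requires. *)
Definition tensor_ker : {pred F} := fun u : F =>
  `[< forall S : zmodClosed F,
        (forall v, tensor_relator v -> v \in S) -> u \in S >].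

Fact tensor_ker_closed : zmod_closed tensor_ker.
Proof.
split=> [|u v /asboolP uI /asboolP vI]; apply/asboolP => S SI.
  exact: rpred0.
by apply: rpredB; [exact: uI | exact: vI].
Qed.

HB.instance Definition _ := GRing.isZmodClosed.Build F tensor_ker
  tensor_ker_closed.

Definition tensor : Type := Quotient.quot tensor_ker.

HB.instance Definition _ := GRing.Zmodule.on tensor.

Definition tens (x : M) (y : N) : tensor :=
  \pi_(Quotient.quot tensor_ker) (<< (x, y) >> : F).


Local Notation "x ⊗ y" := (tens x y) : ring_scope.

Lemma tens_ker (u v : F) : tensor_ker (u - v) ->
  \pi_(Quotient.quot tensor_ker) u = \pi v.
Proof. by move=> uv; apply/eqP; rewrite -Quotient.idealrBE. Qed.

Lemma tensor_relator_ker (u : F) : tensor_relator u -> tensor_ker u.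
Proof. by move=> ru; apply/asboolP => S; apply. Qed.

Lemma tensDl x x' y : (x + x') ⊗ y = x ⊗ y + x' ⊗ y.
Proof.
rewrite /tens -raddfD; apply: tens_ker.
by rewrite opprD addrA; apply: tensor_relator_ker; exact: TensorDl.
Qed.

Lemma tensDr x y y' : x ⊗ (y + y') = x ⊗ y + x ⊗ y'.
Proof.
rewrite /tens -raddfD; apply: tens_ker.
by rewrite opprD addrA; apply: tensor_relator_ker; exact: TensorDr.
Qed.

Lemma tensA x r y : (x ↼ r) ⊗ y = x ⊗ (r *: y).
Proof.
by rewrite /tens; apply: tens_ker; apply: tensor_relator_ker; exact: TensorA.
Qed.

Lemma tensor_ind (P : tensor -> Prop) :
  P 0 -> (forall t u, P t -> P u -> P (t + u)) -> (forall t, P t -> P (- t)) ->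
  (forall x y, P (x ⊗ y)) -> forall t, P t.
Proof.
move=> P0 PD PN Pxy t; rewrite -[t]reprK.
set u : F := repr t; rewrite -[u]freeg_sumE.
rewrite (raddf_sum (\pi_(Quotient.quot tensor_ker))).
elim/big_ind: _ => // -[x y] _.
have -> k : (<< k *g (x, y) >> : F) = << (x, y) >> *~ k.
  by rewrite freeg_mulz mulrzz mul1r.
rewrite raddfMz -/(tens x y).
have Pn n : P (x ⊗ y *+ n) by elim: n => // n IHn; rewrite mulrS; exact: PD.
by case: (coeff _ u) => n; [exact: Pn | exact/PN/Pn].
Qed.

Section Lift.
Variables (G : zmodType) (f : M -> N -> G).
Hypotheses (fDl : forall x x' y, f (x + x') y = f x y + f x' y)
           (fDr : forall x y y', f x (y + y') = f x y + f x y')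
           (fA : forall x r y, f (x ↼ r) y = f x (r *: y)).

Let free_lift : F -> zmodule G := fglift (fun p : M * N => f p.1 p.2 : zmodule G).

Let free_liftB (u v : F) : free_lift (u - v) = free_lift u - free_lift v.
Proof. exact: lift_is_additive. Qed.

Let free_lift0 : free_lift 0 = 0.
Proof. by rewrite -(subrr 0) free_liftB subrr. Qed.

Let free_liftU x y : free_lift << (x, y) >> = f x y.
Proof. by rewrite /free_lift liftU scale1r. Qed.

Let lift_ker : {pred F} := fun u => free_lift u == 0.

Let lift_ker_closed : zmod_closed lift_ker.
Proof.
split=> [|u v]; rewrite !unfold_in; first by rewrite free_lift0.
by move=> /eqP u0 /eqP v0; rewrite free_liftB u0 v0 subrr.
Qed.

HB.instance Definition _ := GRing.isZmodClosed.Build F lift_ker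
  lift_ker_closed.

Let free_lift_ker (u : F) : u \in tensor_ker -> free_lift u = 0.
Proof.
move=> /asboolP/(_ lift_ker) uS; apply/eqP/uS => v.
case=> [x x' y|x y y'|x r y]; rewrite unfold_in !free_liftB !free_liftU.
- by rewrite fDl addrAC addrK subrr.
- by rewrite fDr addrAC addrK subrr.
- by rewrite fA subrr.
Qed.

Definition tensor_lift (t : tensor) : G := free_lift (repr t).

Let tensor_lift_pi (u : F) :
  tensor_lift (\pi_(Quotient.quot tensor_ker) u) = free_lift u.
Proof.
apply/eqP; rewrite -subr_eq0 -free_liftB; apply/eqP/free_lift_ker.
by rewrite Quotient.idealrBE reprK.
Qed.

Lemma tensor_liftE x y : tensor_lift (x ⊗ y) = f x y.
Proof. by rewrite tensor_lift_pi free_liftU. Qed.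

Lemma tensor_liftD t u : tensor_lift (t + u) = tensor_lift t + tensor_lift u.
Proof.
rewrite -[t]reprK -[u]reprK -(raddfD (\pi_(Quotient.quot tensor_ker))).
rewrite !tensor_lift_pi -[in LHS](opprK (repr u)) free_liftB.
by rewrite -(sub0r (repr u)) free_liftB free_lift0 sub0r opprK.
Qed.

End Lift.

Lemma tensor_ext (G : zmodType) (g h : tensor -> G) :
  {morph g : t u / t + u} -> {morph h : t u / t + u} ->
  (forall x y, g (x ⊗ y) = h (x ⊗ y)) -> forall t, g t = h t.
Proof.
have morph0 (k : tensor -> G) : {morph k : t u / t + u} -> k 0 = 0.
  by move=> kD; apply: (addrI (k 0)); rewrite -kD !addr0.
have morphN (k : tensor -> G) t : {morph k : t u / t + u} -> k (- t) = - k t.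
  by move=> kD; apply: (addrI (k t)); rewrite -kD !subrr morph0.
move=> gD hD gh; apply: tensor_ind => //; first by rewrite !morph0.
  by move=> t u gt gu; rewrite gD hD gt gu.
by move=> t gt; rewrite !morphN ?gt.
Qed.

Definition tensor_lscale (r : R) : tensor -> tensor :=
  tensor_lift (fun x y => (r *: x) ⊗ y).

Lemma tensor_lscaleE r x y : tensor_lscale r (x ⊗ y) = (r *: x) ⊗ y.
Proof.
apply: (@tensor_liftE _ (fun x y => (r *: x) ⊗ y)) => {x y} *.
- by rewrite scalerDr tensDl.
- by rewrite tensDr.
- by rewrite -rscaleAl tensA.
Qed.

Fact tensor_lscaleDr : right_distributive tensor_lscale +%R.
Proof.
move=> r; apply: (@tensor_liftD _ (fun x y => (r *: x) ⊗ y)) => *.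
- by rewrite scalerDr tensDl.
- by rewrite tensDr.
- by rewrite -rscaleAl tensA.
Qed.

Fact tensor_lscaleA r s t :
  tensor_lscale r (tensor_lscale s t) = tensor_lscale (r * s) t.
Proof.
move: t; apply: tensor_ext => [t u|t u|x y]; rewrite ?tensor_lscaleDr //.
by rewrite !tensor_lscaleE scalerA.
Qed.

Fact tensor_lscale1 : left_id 1 tensor_lscale.
Proof.
apply: tensor_ext => [t u|t u|x y]; rewrite ?tensor_lscaleDr //.
by rewrite tensor_lscaleE scale1r.
Qed.

Fact tensor_lscaleDl t : {morph tensor_lscale^~ t : r s / r + s}.
Proof.
move=> r s; move: t; apply: tensor_ext => [t u|t u|x y].
- exact: tensor_lscaleDr.
- by rewrite !tensor_lscaleDr addrACA.
- by rewrite !tensor_lscaleE scalerDl tensDl.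
Qed.

HB.instance Definition _ := GRing.Zmodule_isLmodule.Build R tensor
  tensor_lscaleA tensor_lscale1 tensor_lscaleDr tensor_lscaleDl.

Lemma tensZl r x y : r *: (x ⊗ y) = (r *: x) ⊗ y.
Proof. exact: tensor_lscaleE. Qed.

Definition tensor_rscale (t : tensor) (r : R) : tensor :=
  tensor_lift (fun x y => x ⊗ (y ↼ r)) t.

Lemma tensor_rscaleE x y r : tensor_rscale (x ⊗ y) r = x ⊗ (y ↼ r).
Proof.
apply: (@tensor_liftE _ (fun x y => x ⊗ (y ↼ r))) => {x y} *.
- by rewrite tensDl.
- by rewrite rscaleDl tensDr.
- by rewrite rscaleAl tensA.
Qed.

Fact tensor_rscaleDl r t u :
  tensor_rscale (t + u) r = tensor_rscale t r + tensor_rscale u r.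
Proof.
apply: (@tensor_liftD _ (fun x y => x ⊗ (y ↼ r))) => *.
- by rewrite tensDl.
- by rewrite rscaleDl tensDr.
- by rewrite rscaleAl tensA.
Qed.

Fact tensor_rscaleA t r s :
  tensor_rscale (tensor_rscale t r) s = tensor_rscale t (r * s).
Proof.
move: t; apply: (@tensor_ext _ (fun t => tensor_rscale (tensor_rscale t r) s)
  (tensor_rscale^~ (r * s))) => [t u|t u|x y]; rewrite ?tensor_rscaleDl //.
by rewrite !tensor_rscaleE rscaleA.
Qed.

Fact tensor_rscale1 t : tensor_rscale t 1 = t.
Proof.
move: t; apply: (@tensor_ext _ (tensor_rscale^~ 1) id) => [t u|t u|x y] //.
  by rewrite tensor_rscaleDl.
by rewrite tensor_rscaleE rscale1.
Qed.

Fact tensor_rscaleDr t r s :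
  tensor_rscale t (r + s) = tensor_rscale t r + tensor_rscale t s.
Proof.
move: t; apply: (@tensor_ext _ (tensor_rscale^~ (r + s))
  (fun t => tensor_rscale t r + tensor_rscale t s)) => [t u|t u|x y].
- exact: tensor_rscaleDl.
- by rewrite !tensor_rscaleDl addrACA.
- by rewrite !tensor_rscaleE rscaleDr tensDr.
Qed.

Fact tensor_rscaleAl r t s :
  tensor_rscale (r *: t) s = r *: tensor_rscale t s.
Proof.
move: t; apply: (@tensor_ext _ (fun t => tensor_rscale (r *: t) s)
  (fun t => r *: tensor_rscale t s)) => [t u|t u|x y].
- by rewrite scalerDr tensor_rscaleDl.
- by rewrite tensor_rscaleDl scalerDr.
- by rewrite tensZl !tensor_rscaleE tensZl.
Qed.

HB.instance Definition _ := Lmodule_isBimodule.Build R tensor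
  tensor_rscaleA tensor_rscale1 tensor_rscaleDl tensor_rscaleDr
  tensor_rscaleAl.

Lemma tensZr x y r : (x ⊗ y) ↼ r = x ⊗ (y ↼ r).
Proof. exact: tensor_rscaleE. Qed.

End Tensor.

Notation "x ⊗ y" := (tens x y) : ring_scope.

Section TensorPower.
Variables (R : nzRingType) (M : bimodType R).

(* Tensor factors are associated to the right: M ⊗ (M ⊗ (... ⊗ M)). *)
Fixpoint tensor_power (n : nat) : bimodType R :=
  match n with
  | 0 => R^o
  | 1 => M
  | (n'.+1 as n1).+1 => tensor M (tensor_power n1)
  end.

(* [tensor_prod m] is the pure tensor m_0 ⊗ ... ⊗ m_(n-1). *)
Fixpoint tensor_prod (n : nat) : ('I_n -> M) -> tensor_power n :=
  match n return ('I_n -> M) -> tensor_power n with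
  | 0 => fun=> (1 : R)
  | n1.+1 =>
    match n1 return (('I_n1 -> M) -> tensor_power n1) ->
                    ('I_n1.+1 -> M) -> tensor_power n1.+1 with
    | 0 => fun _ m => m ord0
    | n2.+1 => fun prod m => m ord0 ⊗ prod (fun i => m (fintype.lift ord0 i))
    end (@tensor_prod n1)
  end.

(* phi (m_0 ⊗ ... ⊗ m_(n-1)) m_n = m_0 phi (m_1 ⊗ ... ⊗ m_n) *)
Definition associative_morphism (n : nat) (phi : tensor_power n -> R^o) :
    Prop :=
  forall m : 'I_n.+1 -> M,
    (phi (tensor_prod (fun i => m (widen_ord (leqnSn n) i))) : R) *: m ord_max =
    m ord0 ↼ (phi (tensor_prod (fun i => m (fintype.lift ord0 i))) : R).

End TensorPower.

Definition injective_module (R : nzRingType) (E : lmodType R) : Prop :=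
  forall (A B : lmodType R) (i : {linear A -> B}) (f : {linear A -> E}),
    injective i -> exists g : {linear B -> E}, forall a, g (i a) = f a.

Definition quasi_frobenius (K : fieldType) (R : falgType K) : Prop :=
  injective_module (R^o : lmodType R).

(* Main.v *)
Require Import Defs.
From HB Require Import structures.
From mathcomp Require Import all_boot all_algebra all_field.
From mathcomp Require Import boolp classical_sets.

Set Implicit Arguments.
Unset Strict Implicit.
Unset Printing Implicit Defensive.

Import GRing.Theory.
Local Open Scope ring_scope.

(** Write [M] for the bimodule [dual R], let [f] be an isomorphism from the
    [n]-th tensor power of [M] to [R], and let [eps m := m 1], a linear form on
    [M] with [eps (r *: m) = eps (m ↼ r)].

    Self-injectivity.  [M] is an injective left module: a map from a module
    [A] to [M] amounts to a [K]-linear form on [A], and linear forms on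
    subspaces extend, subspaces having complements by Zorn's lemma
    ([dual_injective]).  Write [f (\sum_j x_j ⊗ t_j) = 1] with the [x_j] in
    [M].  Then [r |-> (r *: x_j)_j] embeds [R] as a left module in a finite
    power of [M], and [(y_j)_j |-> \sum_j f (y_j ⊗ t_j)] is a retraction; so
    [R] is injective too ([injective_of_tensor_onto]).

    Associativity.  Because [M] is invertible, every isomorphism [f] is
    associative up to a defect: there is a map [theta] of [M] to itself with
      [f (m_0 ⊗ .. ⊗ m_(n-1)) m_n = theta m_0 f (m_1 ⊗ .. ⊗ m_n)]
    ([defect_exists]).  Two computations show that [theta] is the identity.
    Moving the scalar [f (m_0 ⊗ .. ⊗ m_(n-1))] through [n] further factors
    applies [theta] to [m_0, .., m_(n-1)], whence
      [f (theta m_0 ⊗ .. ⊗ theta m_(n-1)) = f (m_0 ⊗ .. ⊗ m_(n-1))]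
    ([defect_invariant]).  On the other hand, the trace property of [eps] makes
    [eps (f (m_0 ⊗ .. ⊗ m_(n-1)) m_n)] invariant under cyclic rotation of
    [m_0, .., m_n], at the price of one [theta] on the factor that is moved
    ([trace_rotation]); after a full turn
      [eps (f (m_0 ⊗ ..) m_n) = eps (f (theta m_0 ⊗ ..) (theta m_n))
                              = eps (f (m_0 ⊗ ..) (theta m_n))].
    Since [f] is onto and [eps] is nondegenerate, [theta m_n = m_n].

    Finally an arbitrary morphism is [f] times a central element [c] of [R],
    and [c] acts on [M] in the same way from both sides, so associativity
    passes from [f] to all morphisms ([trace_form_associative]).  All of this
    holds for any invertible bimodule with a nondegenerate trace form. *)

(** * Tensor products and powers of bimodules *)

Section TensorProducts.
Variable R : nzRingType.

Lemma morphism_add (M N : bimodType R) (f : M -> N) :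
  bimodule_morphism f -> {morph f : x y / x + y}.
Proof. by case=> fL _ x y; rewrite -[x]scale1r fL !scale1r. Qed.

Lemma morphism_scale (M N : bimodType R) (f : M -> N) :
  bimodule_morphism f -> forall r x, f (r *: x) = r *: f x.
Proof.
move=> f_mor r x; have [fL _] := f_mor.
have f0 : f 0 = 0.
  by apply: (addrI (f 0)); rewrite -(morphism_add f_mor) !addr0.
by rewrite -[r *: x]addr0 fL f0 addr0.
Qed.

Lemma tensor_sum_tens (M N : bimodType R) (t : tensor M N) :
  exists s : seq (M * N), t = \sum_(p <- s) p.1 ⊗ p.2.
Proof.
elim/tensor_ind: t => [|t u [s ->] [s' ->]|t [s ->]|x y].
- by exists [::]; rewrite big_nil.
- by exists (s ++ s'); rewrite big_cat.
- exists [seq (- p.1, p.2) | p <- s]; rewrite big_map -sumrN.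
  apply: eq_bigr => p _ /=.
  by rewrite -!scaleN1r -tensZl.
- by exists [:: (x, y)]; rewrite big_seq1.
Qed.

Section LinearLift.
Variables (M N P : bimodType R) (h : M -> N -> P).
Hypotheses (hDl : forall x x' y, h (x + x') y = h x y + h x' y)
  (hDr : forall x y y', h x (y + y') = h x y + h x y')
  (hA : forall x r y, h (x ↼ r) y = h x (r *: y))
  (hR : forall x y r, h x (y ↼ r) = h x y ↼ r).

Lemma tensor_lift_right_linear :
  [/\ {morph tensor_lift h : t u / t + u},
      forall t r, tensor_lift h (t ↼ r) = tensor_lift h t ↼ r &
      forall x y, tensor_lift h (x ⊗ y) = h x y].
Proof.
have gD : {morph tensor_lift h : t u / t + u} by exact: tensor_liftD.
have gE x y : tensor_lift h (x ⊗ y) = h x y by exact: tensor_liftE.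
split=> // t r; move: t.
apply: (tensor_ext (g := fun t => tensor_lift h (t ↼ r))
  (h := fun t => tensor_lift h t ↼ r)) => [t u|t u|x y].
- by rewrite rscaleDl gD.
- by rewrite gD rscaleDl.
- by rewrite tensZr !gE hR.
Qed.

Hypothesis hZ : forall r x y, h (r *: x) y = r *: h x y.

Lemma tensor_lift_morphism : bimodule_morphism (tensor_lift h).
Proof.
have [gD gR gE] := tensor_lift_right_linear.
split=> // r t u; rewrite gD; congr (_ + _); move: t.
apply: (tensor_ext (g := fun t => tensor_lift h (r *: t))
  (h := fun t => r *: tensor_lift h t)) => [t v|t v|x y].
- by rewrite scalerDr gD.
- by rewrite gD scalerDr.
- by rewrite tensZl !gE hZ.
Qed.

End LinearLift.

Lemma tensor_assoc (M N P : bimodType R) :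
  exists2 g : tensor M (tensor N P) -> tensor (tensor M N) P,
    bimodule_morphism g & forall x y z, g (x ⊗ (y ⊗ z)) = (x ⊗ y) ⊗ z.
Proof.
pose h x : tensor N P -> tensor (tensor M N) P :=
  tensor_lift (fun y z => (x ⊗ y) ⊗ z).
have h_lift x : [/\ {morph h x : t u / t + u},
    forall t r, h x (t ↼ r) = h x t ↼ r &
    forall y z, h x (y ⊗ z) = (x ⊗ y) ⊗ z].
  apply: tensor_lift_right_linear => *.
  - by rewrite tensDr tensDl.
  - by rewrite tensDr.
  - by rewrite -tensA tensZr.
  - by rewrite tensZr.
have hD x : {morph h x : t u / t + u} by have [] := h_lift x.
have hE x y z : h x (y ⊗ z) = (x ⊗ y) ⊗ z by have [] := h_lift x.
have hDl x x' t : h (x + x') t = h x t + h x' t.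
  move: t; apply: (tensor_ext (h := fun t => h x t + h x' t)) => [t u|t u|y z].
  - exact: hD.
  - by rewrite !hD addrACA.
  - by rewrite !hE !tensDl.
have hA x r t : h (x ↼ r) t = h x (r *: t).
  move: t; apply: (tensor_ext (h := fun t => h x (r *: t))) => [t u|t u|y z].
  - exact: hD.
  - by rewrite scalerDr hD.
  - by rewrite tensZl !hE tensA.
have hZ r x t : h (r *: x) t = r *: h x t.
  move: t; apply: (tensor_ext (h := fun t => r *: h x t)) => [t u|t u|y z].
  - exact: hD.
  - by rewrite hD scalerDr.
  - by rewrite !hE !tensZl.
have hR x t r : h x (t ↼ r) = h x t ↼ r by have [] := h_lift x.
exists (tensor_lift h) => [|x y z]; first exact: tensor_lift_morphism.
by have [_ _ ->] := tensor_lift_right_linear hDl hD hA hR; rewrite hE.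
Qed.

Lemma tensor_map_right (M N P : bimodType R) (a : N -> P) :
  bimodule_morphism a ->
  exists2 g : tensor M N -> tensor M P,
    bimodule_morphism g & forall x y, g (x ⊗ y) = x ⊗ a y.
Proof.
move=> a_mor; pose h (x : M) (y : N) := x ⊗ a y.
have [_ aR] := a_mor.
have hDl x x' y : h (x + x') y = h x y + h x' y by exact: tensDl.
have hDr x y y' : h x (y + y') = h x y + h x y'.
  by rewrite /h (morphism_add a_mor) tensDr.
have hA x r y : h (x ↼ r) y = h x (r *: y).
  by rewrite /h (morphism_scale a_mor) tensA.
have hR x y r : h x (y ↼ r) = h x y ↼ r by rewrite /h aR tensZr.
have hZ r x y : h (r *: x) y = r *: h x y by rewrite /h tensZl.
exists (tensor_lift h) => [|x y]; first exact: tensor_lift_morphism.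
by have [_ _ ->] := tensor_lift_right_linear hDl hDr hA hR.
Qed.

End TensorProducts.

Section TensorPowers.
Variables (R : nzRingType) (M : bimodType R).

(** Indexing the factors by all of [nat] makes shifting and splicing of pure
    tensors plain operations on functions; only [m 0, .., m k.-1] matter. *)
Definition seq_tensor (k : nat) (m : nat -> M) : tensor_power M k :=
  tensor_prod (fun i : 'I_k => m i).

Lemma seq_tensorS k m :
  seq_tensor k.+2 m = m 0%N ⊗ seq_tensor k.+1 (fun i => m i.+1).
Proof. by []. Qed.

Lemma eq_seq_tensor k (m m' : nat -> M) :
  (forall i, (i < k)%N -> m i = m' i) -> seq_tensor k m = seq_tensor k m'.
Proof.
move=> mm'; congr (tensor_prod _).
by apply: funext => i; apply: mm'; exact: ltn_ord.
Qed.

Lemma seq_tensor_ext k (G : zmodType) (g h : tensor_power M k.+1 -> G) :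
  {morph g : t u / t + u} -> {morph h : t u / t + u} ->
  (forall m, g (seq_tensor k.+1 m) = h (seq_tensor k.+1 m)) ->
  forall t, g t = h t.
Proof.
elim: k g h => [|k IHk] g h gD hD gh t; first exact: (gh (fun=> t)).
move: t; apply: tensor_ext => // x; apply: IHk => [t u|t u|m].
- by rewrite tensDr gD.
- by rewrite tensDr hD.
- exact: (gh (fun i => if i is j.+1 then m j else x)).
Qed.

(** Tensor powers are bracketed to the right, so their last factor is buried;
    this reassociation brings it out. *)
Lemma tensor_power_split_last k :
  exists2 a : tensor_power M k.+2 -> tensor (tensor_power M k.+1) M,
    bimodule_morphism a &
    forall m, a (seq_tensor k.+2 m) = seq_tensor k.+1 m ⊗ m k.+1.
Proof.
elim: k => [|k [a a_mor aE]]; first by exists id.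
have [g [gL gR] gE] := tensor_map_right M a_mor.
have [h [hL hR] hE] := tensor_assoc M (tensor_power M k.+1) M.
exists (h \o g) => [|m]; last by rewrite /= seq_tensorS gE aE hE.
by split=> [r t u|t r] /=; rewrite (gL, gR) (hL, hR).
Qed.

End TensorPowers.

(** * Associativity of invertible bimodules with a trace form *)

Section Defect.
Variables (R : nzRingType) (M : bimodType R) (k : nat).
Local Notation n := k.+2.
Variable f : tensor_power M n -> (R^o : bimodType R).
Hypotheses (f_mor : bimodule_morphism f) (f_bij : bijective f).

(** For fixed [x], the right linear map sending
    [m_1 ⊗ .. ⊗ m_n] to [f (x ⊗ m_1 ⊗ .. ⊗ m_(n-1)) m_n] is defined on a free
    right module of rank one, generated by the element [f' 1] that [f] sends
    to [1]; hence it is the multiplication of its value at this generator,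
    which is [theta x], by the coordinate [f]. *)
Lemma defect_exists : exists theta : M -> M, forall m : nat -> M,
  (f (seq_tensor n m) : R) *: m n =
  theta (m 0%N) ↼ (f (seq_tensor n (fun i => m i.+1)) : R).
Proof.
have [f' fK f'K] := f_bij; have [_ fR] := f_mor.
have fD := morphism_add f_mor.
have [a [aL aR] aE] := tensor_power_split_last M k.
pose h x (t : tensor_power M k.+1) (y : M) : M := (f (x ⊗ t) : R) *: y.
have hDl x t t' y : h x (t + t') y = h x t y + h x t' y.
  by rewrite /h tensDr fD scalerDl.
have hDr x t y y' : h x t (y + y') = h x t y + h x t y' by exact: scalerDr.
have hA x t r y : h x (t ↼ r) y = h x t (r *: y).
  by rewrite /h -tensZr fR scalerA.
have hR x t y r : h x t (y ↼ r) = h x t y ↼ r by rewrite /h rscaleAl.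
have gR x t r : tensor_lift (h x) (t ↼ r) = tensor_lift (h x) t ↼ r.
  by have [_ ->] := tensor_lift_right_linear (hDl x) (hDr x) (hA x) (hR x).
have gE x t y : tensor_lift (h x) (t ⊗ y) = h x t y.
  by have [_ _ ->] := tensor_lift_right_linear (hDl x) (hDr x) (hA x) (hR x).
exists (fun x => tensor_lift (h x) (a (f' 1))) => m.
rewrite -gR -aR.
have -> : f' 1 ↼ (f (seq_tensor n (fun i => m i.+1)) : R) =
    seq_tensor n (fun i => m i.+1).
  by apply: (can_inj fK); rewrite fR f'K; exact: mul1r.
by rewrite aE gE.
Qed.

Variable theta : M -> M.
Hypothesis thetaE : forall m : nat -> M,
  (f (seq_tensor n m) : R) *: m n =
  theta (m 0%N) ↼ (f (seq_tensor n (fun i => m i.+1)) : R).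

(** Moving the scalar one factor to the right is the equation of [thetaE];
    the next factors see a scalar of the same shape, shifted by one, because
    scalars pass freely through the tensor sign. *)
Lemma scalar_passes j (m : nat -> M) :
  (f (seq_tensor n m) : R) *: seq_tensor j.+1 (fun i => m (i + n)%N) =
  seq_tensor j.+1 (theta \o m) ↼
    (f (seq_tensor n (fun i => m (i + j.+1)%N)) : R).
Proof.
elim: j m => [|j IHj] m.
  rewrite (thetaE m) (@eq_seq_tensor _ _ n (fun i => m (i + 1)%N)
    (fun i => m i.+1)) // => i _.
  by rewrite addn1.
rewrite !(seq_tensorS j) tensZl (thetaE m) tensA.
have -> : seq_tensor j.+1 (fun i => m (i.+1 + n)%N) =
          seq_tensor j.+1 (fun i => m (i + n).+1) by [].
rewrite (IHj (fun i => m i.+1)) tensZr.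
rewrite (@eq_seq_tensor _ _ n (fun i => m (i + j.+2)%N)
  (fun i => m (i + j.+1).+1)) // => i _.
by rewrite addnS.
Qed.

(** Both sides are compared after multiplication by a pure tensor [m'], placed
    right after [m] in one sequence [w], through which the scalar moves. *)
Lemma defect_invariant m : f (seq_tensor n (theta \o m)) = f (seq_tensor n m).
Proof.
have [f' fK f'K] := f_bij; have [_ fR] := f_mor.
have fD := morphism_add f_mor; have fZ := morphism_scale f_mor.
have key t : (f (seq_tensor n m) : R) *: t =
    seq_tensor n (theta \o m) ↼ (f t : R).
  move: t; apply: (seq_tensor_ext (g := fun t => (f (seq_tensor n m) : R) *: t)
     (h := fun t => seq_tensor n (theta \o m) ↼ (f t : R))) => [t u|t u|m'].
  - exact: scalerDr.
  - by rewrite fD rscaleDr.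
  pose w i := if (i < n)%N then m i else m' (i - n)%N.
  have := scalar_passes k.+1 w.
  have -> : seq_tensor n (fun i => w (i + n)%N) = seq_tensor n m'.
    apply: eq_seq_tensor => i _.
    by rewrite /w ltnNge leq_addl /= addnK.
  have -> : seq_tensor n w = seq_tensor n m.
    by apply: eq_seq_tensor => i; rewrite /w => ->.
  have -> // : seq_tensor n (theta \o w) = seq_tensor n (theta \o m).
  by apply: eq_seq_tensor => i; rewrite /w /= => ->.
have := congr1 f (key (f' 1)); rewrite fZ fR f'K /=.
by rewrite [LHS]mulr1 [RHS]mulr1.
Qed.

Variables (G : zmodType) (eps : M -> G).
Hypotheses (epsD : {morph eps : x y / x + y})
  (epsC : forall r x, eps (r *: x) = eps (x ↼ r))
  (eps_nondeg : forall x y, (forall r, eps (r *: x) = eps (r *: y)) -> x = y).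

(** A cyclic rotation of [n.+1] factors is a shift of the sequence in which
    they are repeated, each turn applying [theta] once more. *)
Lemma trace_rotation (w : nat -> M) :
  (forall i, w (i + n.+1)%N = theta (w i)) -> forall j,
  eps ((f (seq_tensor n w) : R) *: w n) =
  eps ((f (seq_tensor n (fun i => w (i + j)%N)) : R) *: w (n + j)%N).
Proof.
move=> w_per; elim=> [|j ->].
  rewrite addn0 (@eq_seq_tensor _ _ n (fun i => w (i + 0)%N) w) // => i _.
  by rewrite addn0.
rewrite (thetaE (fun i => w (i + j)%N)) -epsC -w_per.
rewrite add0n (addnC j) (addSnnS n).
rewrite (@eq_seq_tensor _ _ n (fun i => w (i + j.+1)%N)
  (fun i => w (i.+1 + j)%N)) // => i _.
by rewrite addSnnS.
Qed.

Lemma defect_id x : theta x = x.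
Proof.
have [f' fK f'K] := f_bij; have fD := morphism_add f_mor.
have fZ := morphism_scale f_mor.
apply: eps_nondeg => r.
suff key t : eps ((f t : R) *: theta x) = eps ((f t : R) *: x).
  by rewrite -[r]f'K.
move: t; apply: (seq_tensor_ext (g := fun t => eps ((f t : R) *: theta x))
   (h := fun t => eps ((f t : R) *: x))) => [t u|t u|m].
- by rewrite fD scalerDl epsD.
- by rewrite fD scalerDl epsD.
(* The factors [m 0, .., m n.-1, x], repeated as [trace_rotation] requires. *)
pose c i := if (i < n)%N then m i else x.
pose w i := iter (i %/ n.+1) theta (c (i %% n.+1)%N).
have w_per i : w (i + n.+1)%N = theta (w i).
  by rewrite /w divnDr // divnn modnDr addn1.
have w_lt i : (i <= n)%N -> w i = c i.
  by move=> le_in; rewrite /w divn_small // modn_small.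
have wn : w n = x by rewrite w_lt // /c ltnn.
have fw : seq_tensor n w = seq_tensor n m.
  by apply: eq_seq_tensor => i lt_in; rewrite w_lt 1?ltnW // /c lt_in.
have := trace_rotation w_per n.+1.
have -> : seq_tensor n (fun i => w (i + n.+1)%N) = seq_tensor n (theta \o w).
  by apply: eq_seq_tensor => i _; rewrite w_per.
by rewrite w_per wn defect_invariant fw => <-.
Qed.

End Defect.

(** A morphism [phi] is [f] multiplied by [c := phi (f' 1)], where [f] maps
    [f' 1] to [1]; left and right linearity of [phi] force [c] to be central,
    and the trace form then cannot distinguish [c *: x] from [x ↼ c]. *)
Theorem trace_form_associative (R : nzRingType) (M : bimodType R)
    (k : nat) (G : zmodType) (eps : M -> G) :
  bimodule_iso (tensor_power M k.+2) (R^o : bimodType R) ->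
  {morph eps : x y / x + y} ->
  (forall r x, eps (r *: x) = eps (x ↼ r)) ->
  (forall x y, (forall r, eps (r *: x) = eps (r *: y)) -> x = y) ->
  forall phi : tensor_power M k.+2 -> (R^o : bimodType R),
    bimodule_morphism phi -> associative_morphism phi.
Proof.
move=> [f f_mor f_bij] epsD epsC eps_nondeg phi phi_mor m.
have [theta thetaE] := defect_exists f_mor f_bij.
have thetaI := defect_id f_mor f_bij thetaE epsD epsC eps_nondeg.
have [f' fK f'K] := f_bij.
have fZ := morphism_scale f_mor; have [_ fR] := f_mor.
have phiZ := morphism_scale phi_mor; have [_ phiR] := phi_mor.
pose c : R := phi (f' 1).
have phiE t : phi t = (f t : R) * c :> R.
  have -> : (f t : R) * c = phi ((f t : R) *: f' 1) by rewrite phiZ.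
  by congr (phi _); apply: (can_inj fK); rewrite fZ f'K; symmetry; exact: mulr1.
have cC r : r * c = c * r.
  rewrite -[r]f'K -phiE -[in LHS](fK (f' r)) f'K.
  have <- : f' 1 ↼ r = f' r.
    by apply: (can_inj fK); rewrite fR !f'K; exact: mul1r.
  exact: phiR.
have c_act (x : M) : c *: x = x ↼ c.
  apply: eps_nondeg => r.
  by rewrite scalerA -rscaleAl -epsC scalerA cC.
pose w i := m (inord i).
have wn : w k.+2 = m ord_max.
  by congr m; apply: val_inj; rewrite /= inordK.
have w0 : w 0%N = m ord0.
  by congr m; apply: val_inj; rewrite /= inordK.
have wl : seq_tensor k.+2 w =
    tensor_prod (fun i => m (widen_ord (leqnSn k.+2) i)).
  congr (tensor_prod _); apply: funext => i.
  by congr m; apply: val_inj; rewrite /= inordK // ltnW // ltnS.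
have wr : seq_tensor k.+2 (fun i => w i.+1) =
    tensor_prod (fun i => m (fintype.lift ord0 i)).
  congr (tensor_prod _); apply: funext => i.
  by congr m; apply: val_inj; rewrite /= inordK // ltnS.
rewrite -wl -wr -wn -w0 !phiE.
by rewrite cC -scalerA thetaE thetaI c_act rscaleA.
Qed.

(** * Injectivity *)

Section Splitting.
Variables (K : fieldType) (U V : lmodType K) (i : U -> V).
Hypotheses (i_lin : linear i) (i_inj : injective i).

(** Membership of [0] is left out, so that the condition also holds for the
    union of the empty chain in Zorn's lemma. *)
Definition transverse (W : set V) : Prop :=
  (forall k x y, W x -> W y -> W (k *: x + y)) /\
  (forall u, W (i u) -> u = 0).

Let i0 : i 0 = 0.
Proof. by have := i_lin (-1) 0 0; rewrite scaler0 addr0 scaleN1r addNr. Qed.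

Let iZ k u : i (k *: u) = k *: i u.
Proof. by rewrite -[k *: u]addr0 i_lin i0 addr0. Qed.

Let iB u v : i (u - v) = i u - i v.
Proof. by rewrite addrC -scaleN1r i_lin scaleN1r addrC. Qed.

(** A maximal transverse [W] works: if [v] lies outside [W + i U], then
    [W + K v] is transverse as well. *)
Lemma complement_exists : exists2 W : set V, transverse W & W 0 /\
  forall v, exists u, W (v - i u).
Proof.
have chain (F : set (set V)) : (F `<=` transverse)%classic ->
    total_on F subset -> transverse (\bigcup_(X in F) X)%classic.
  move=> FT Ftot; split=> [k x y [X FX Xx] [Y FY Yy]|u [X FX Xu]].
    have [XY|YX] := Ftot _ _ FX FY.
      by exists Y => //; apply: (FT _ FY).1 => //; exact: XY.
    by exists X => //; apply: (FT _ FX).1 => //; exact: YX.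
  exact: (FT _ FX).2.
have [W [[WL WT] Wmax]] := Zorn_bigcup chain.
have maxW B : transverse B -> (W `<=` B)%classic -> (B `<=` W)%classic.
  by move=> BT WB; apply: contrapT => nBW; apply: (Wmax B).
have W0 : W 0.
  pose B : set V := fun x => W x \/ x = 0.
  apply: (maxW B); [split | by left | by right].
    move=> k x y [Wx|->] [Wy|->].
    - by left; exact: WL.
    - left; rewrite addr0.
      have Ww : W (-1 *: x + x) by exact: WL.
      by rewrite -[k *: x]addr0 -(addNr x) -scaleN1r; exact: WL.
    - by left; rewrite scaler0 add0r.
    - by right; rewrite scaler0 add0r.
  by move=> u [/WT //|iu0]; apply: i_inj; rewrite i0.
exists W => //; split=> // v; apply: contrapT => nv.
pose B : set V := fun x => exists k, W (x - k *: v).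
have Wv : W v.
  apply: (maxW B); [split | | ].
  - move=> k x y [kx Wx] [ky Wy]; exists (k * kx + ky).
    have -> : k *: x + y - (k * kx + ky) *: v =
        k *: (x - kx *: v) + (y - ky *: v).
      by rewrite scalerBr scalerA scalerDl opprD addrACA.
    exact: WL.
  - move=> u [k Wk].
    have [k0|k0] := eqVneq k 0.
      by move: Wk; rewrite k0 scale0r subr0; exact: WT.
    case: nv; exists (k^-1 *: u); rewrite iZ.
    have -> : v - k^-1 *: i u = (- k^-1) *: (i u - k *: v) + 0.
      rewrite addr0 scalerBr scalerA mulNr mulVf // scaleN1r opprK.
      by rewrite scaleNr addrC.
    exact: WL.
  - by move=> x Wx; exists 0; rewrite scale0r subr0.
  - by exists 1; rewrite scale1r subrr.
by apply: nv; exists 0; rewrite i0 subr0.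
Qed.

Lemma linear_retraction : exists2 p : V -> U, linear p & cancel i p.
Proof.
have [W [WL WT] [W0 Wsum]] := complement_exists.
have /choice[p Wp] : forall v, exists u, W (v - i u) by [].
have p_uniq v u : W (v - i u) -> p v = u.
  move=> Wu; apply/eqP; rewrite -subr_eq0; apply/eqP/WT.
  rewrite iB.
  have -> : i (p v) - i u = -1 *: (v - i (p v)) + (v - i u).
    by rewrite scaleN1r opprB addrA subrK.
  by apply: WL; [exact: Wp | ].
exists p => [k x y|u]; apply: p_uniq.
  have -> : k *: x + y - i (k *: p x + p y) =
      k *: (x - i (p x)) + (y - i (p y)).
    by rewrite i_lin scalerBr opprD addrACA.
  by apply: WL; exact: Wp.
by rewrite subrr.
Qed.

End Splitting.

Section Restriction.
Variables (K : fieldType) (R : falgType K) (V : lmodType R).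

Definition restrict_scalars : Type := V.
HB.instance Definition _ := GRing.Zmodule.on restrict_scalars.

Definition restricted_scale (k : K) (v : restrict_scalars) : restrict_scalars :=
  (k%:A : R) *: (v : V).

Fact restricted_scaleA a b v :
  restricted_scale a (restricted_scale b v) = restricted_scale (a * b) v.
Proof. by rewrite /restricted_scale scalerA -scalerAl mul1r scalerA. Qed.

Fact restricted_scale1 : left_id 1 restricted_scale.
Proof. by move=> v; rewrite /restricted_scale !scale1r. Qed.

Fact restricted_scaleDr : right_distributive restricted_scale +%R.
Proof. by move=> k u v; exact: scalerDr. Qed.

Fact restricted_scaleDl v :
  {morph restricted_scale^~ v : a b / a + b}.
Proof. by move=> a b; rewrite /restricted_scale !scalerDl. Qed.

HB.instance Definition _ := GRing.Zmodule_isLmodule.Build K restrict_scalars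
  restricted_scaleA restricted_scale1 restricted_scaleDr restricted_scaleDl.

End Restriction.

Section DualInjective.
Variables (K : fieldType) (R : falgType K).

(** A map [f] of left modules into the dual is determined by the linear form
    [eps \o f] of evaluation at [1], since [f a r = eps (f (r *: a))]; it is
    extended by extending this linear form along a [K]-linear retraction. *)
Lemma dual_injective : injective_module (dual R : lmodType R).
Proof.
move=> A B i f i_inj.
have iK : linear (i : restrict_scalars A -> restrict_scalars B).
  by move=> k x y; exact: linearP.
have [p pL pK] := linear_retraction iK i_inj.
have pD x y : p (x + y) = p x + p y by rewrite -[x]scale1r pL !scale1r.
pose h (b : B) (r : R) : K^o := dual_fun (f (p (r *: b) : A)) 1.
have h_lin b : linear (h b).
  move=> k r s.
  have pE : p ((k *: r + s) *: b) = k *: p (r *: b) + p (s *: b).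
    rewrite -pL; congr p.
    have -> : (k *: (r *: b : restrict_scalars B) : restrict_scalars B) =
      (k%:A : R) *: (r *: b) by [].
    by rewrite scalerDl scalerA -scalerAl mul1r.
  rewrite /h pE.
  have -> : (k *: p (r *: b) + p (s *: b) : restrict_scalars A) =
     (k%:A : R) *: (p (r *: b) : A) + (p (s *: b) : A) by [].
  rewrite linearP dual_addE; congr (_ + _).
  by rewrite [LHS]dual_lscaleE mul1r /dual_fun linearZ.
pose hL b : {linear R -> K^o} :=
  HB.pack (h b) (GRing.isLinear.Build _ _ _ _ _ (h_lin b)).
pose g b : dual R := linfun (hL b).
have gE b r : g b r = h b r by rewrite /g /dual_fun lfunE.
have g_lin : linear g.
  move=> s x y; apply: dualP => r.
  rewrite dual_addE [dual_fun (_ *: _) _]dual_lscaleE !gE /h.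
  by rewrite scalerDr scalerA pD linearD dual_addE.
pose gL : {linear B -> dual R} :=
  HB.pack g (GRing.isLinear.Build _ _ _ _ _ g_lin).
exists gL => a; apply: dualP => r.
by rewrite gE /h -linearZ pK linearZ [LHS]dual_lscaleE mul1r.
Qed.

End DualInjective.

(** The elements [x_j] and [t_j] with [f (\sum_j x_j ⊗ t_j) = 1] make [R] a
    retract of a power of [M]; the extensions of [a |-> g a *: x_j] are
    recombined by [f]. *)
Lemma injective_of_tensor_onto (R : nzRingType) (M N : bimodType R)
    (f : tensor M N -> (R^o : bimodType R)) (t : tensor M N) :
  bimodule_morphism f -> f t = 1 :> R -> injective_module (M : lmodType R) ->
  injective_module (R^o : lmodType R).
Proof.
move=> f_mor ft1 M_inj A B i g i_inj.
have fD := morphism_add f_mor; have fZ := morphism_scale f_mor.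
have f_sum (I : Type) (r : seq I) (F : I -> tensor M N) :
    f (\sum_(j <- r) F j) = \sum_(j <- r) f (F j).
  by apply: (big_morph f fD); rewrite -(scale0r t) fZ scale0r.
have /choice[e eE] : forall x : M, exists e : {linear B -> M},
    forall a, e (i a) = (g a : R) *: x.
  move=> x; have gx_lin : linear (fun a => (g a : R) *: x).
    by move=> r a b; rewrite linearP scalerDl -scalerA.
  pose gx : {linear A -> M} :=
    HB.pack (fun a => (g a : R) *: x) (GRing.isLinear.Build _ _ _ _ _ gx_lin).
  exact: (M_inj _ _ _ gx).
have [s ts] := tensor_sum_tens t.
pose h b : R^o := f (\sum_(p <- s) e p.1 b ⊗ p.2).
have h_lin : linear h.
  move=> r a b; rewrite /h -fZ -fD scaler_sumr -big_split; congr (f _).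
  by apply: eq_bigr => p _; rewrite linearP tensDl tensZl.
pose hL : {linear B -> R^o} :=
  HB.pack h (GRing.isLinear.Build _ _ _ _ _ h_lin).
exists hL => a; rewrite /= /h.
have -> : \sum_(p <- s) e p.1 (i a) ⊗ p.2 = (g a : R) *: t.
  by rewrite ts scaler_sumr; apply: eq_bigr => p _; rewrite eE tensZl.
by rewrite fZ ft1; exact: mulr1.
Qed.

(** * The dual bimodule *)

Theorem theoremB (K : fieldType) (R : falgType K) (n : nat)
    (n_ge2 : (2 <= n)%N)
    (iso_dual : bimodule_iso (tensor_power (dual R) n) (R^o : bimodType R)) :
  quasi_frobenius R /\
  forall phi : tensor_power (dual R) n -> (R^o : bimodType R),
    bimodule_morphism phi -> associative_morphism phi.
Proof.
case: n n_ge2 iso_dual => [|[|k]] // _ iso.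
split.
  have [f f_mor [f' _ f'K]] := iso.
  exact: (injective_of_tensor_onto f_mor (f'K 1) (@dual_injective K R)).
apply: (@trace_form_associative _ _ _ _ (fun m : dual R => m 1 : K)) => //.
- by move=> m m'; rewrite dual_addE.
- by move=> r m; rewrite [LHS]dual_lscaleE [RHS]dual_rscaleE mul1r mulr1.
- move=> m m' mm'; apply: dualP => r; have := mm' r.
  by rewrite [LHS]dual_lscaleE [X in _ = X]dual_lscaleE mul1r.
Qed.
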